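(* Let $A$ be an associative Banach $D$-algebra with unit $1$, $n\ge1$ and $c_1,\dots,c_n\in A$. The quasiexponent $y=e[c_1,\dots,c_n]^x$ is a solution of the differential equation $$\frac{dy}{dx}\circ 1=y .$$
   Context: $D$ is a complete commutative (normed) ring of characteristic $0$; real scalars act on $D$-modules (derivatives are computed with real increments $t\to0$). The exponent is $e^x=\sum_{n=0}^\infty\frac1{n!}x^n$, $x\in A$. The derivative $\frac{df}{dx}$ of $f:A\to A$ at $x$ is the $D$-linear map with $f(x+h)-f(x)=\frac{df}{dx}\circ h+o(h)$; higher derivatives are defined by $\frac{d^{n+1}f}{dx^{n+1}}\circ(h_1,\dots,h_{n+1})=\frac{d}{dx}\bigl(\frac{d^nf}{dx^n}\circ(h_1,\dots,h_n)\bigr)\circ h_{n+1}$. The quasiexponent is the map $e[c_1,\dots,c_n]^x=\frac{d^ne^x}{dx^n}\circ(c_1,\dots,c_n)$. *)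

(* Defs.v *)
From HB Require Import structures.
From mathcomp Require Import all_boot all_order all_algebra.
From mathcomp Require Import all_classical all_reals all_analysis.

Set Implicit Arguments.
Unset Strict Implicit.
Unset Printing Implicit Defensive.

Import Order.TTheory GRing.Theory Num.Theory.
Import numFieldTopology.Exports numFieldNormedType.Exports.

Local Open Scope classical_set_scope.
Local Open Scope ring_scope.

(* A structure joining [Num.NormedZmodule] and [GRing.NzRing] cannot be declared
   after [Num.NumDomain], so the norm is a fresh operation, from which the norm
   and topology of the libraries are then derived; [rnormMn] and [rnormN] are
   axioms of [normedZmodType]. *)
HB.mixin Record hasRingNorm (R : realType) T of GRing.NzRing T := {
  rnorm : T -> R ;
  ler_rnormD : forall x y : T, rnorm (x + y) <= rnorm x + rnorm y ;
  rnorm0_eq0 : forall x : T, rnorm x = 0 -> x = 0 ;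
  rnormMn : forall (x : T) (n : nat), rnorm (x *+ n) = rnorm x *+ n ;
  rnormN : forall x : T, rnorm (- x) = rnorm x ;
  ler_rnormM : forall x y : T, rnorm (x * y) <= rnorm x * rnorm y
}.

#[short(type="normedRingType")]
HB.structure Definition NormedRing (R : realType) :=
  { T of GRing.NzRing T & hasRingNorm R T }.

#[short(type="normedAlgType")]
HB.structure Definition NormedAlgebra (R : realType) (S : pzRingType) :=
  { T of NormedRing R T & GRing.Algebra S T }.

HB.instance Definition _ (R : realType) (T : normedRingType R) :=
  Num.Zmodule_isNormed.Build R T (@ler_rnormD R T) (@rnorm0_eq0 R T)
    (@rnormMn R T) (@rnormN R T).
HB.instance Definition _ (R : realType) (T : normedRingType R) :=
  isPointed.Build T 0.
HB.instance Definition _ (R : realType) (T : normedRingType R) :=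
  PseudoMetric.copy T (pseudoMetric_normed T).
HB.instance Definition _ (R : realType) (T : normedRingType R) :=
  NormedZmod_PseudoMetric_eq.Build R T erefl.

Definition complete_norm (R : realType) (T : normedRingType R) : Prop :=
  forall F : set_system T, ProperFilter F -> cauchy F -> cvg F.

(* Real scalars act on every D-module through D, via [r |-> r%:A : D]. *)
HB.mixin Record isCompleteScalarRing (R : realType) D
    of NormedAlgebra R R D & GRing.ComAlgebra R D := {
  rnormZ : forall (r : R) (d : D), rnorm (r *: d) = `|r| * rnorm d ;
  scalar_complete : complete_norm (D : normedRingType R)
}.

#[short(type="completeScalarRingType")]
HB.structure Definition CompleteScalarRing (R : realType) :=
  { D of NormedAlgebra R R D & GRing.ComAlgebra R D & isCompleteScalarRing R D }.

HB.mixin Record isBanachAlgebra (R : realType) (D : completeScalarRingType R) A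
    of NormedAlgebra R D A := {
  ler_rnormZ : forall (d : D) (a : A), rnorm (d *: a) <= rnorm d * rnorm a ;
  banach_complete : complete_norm (A : normedRingType R)
}.

#[short(type="banachAlgType")]
HB.structure Definition BanachAlgebra (R : realType)
    (D : completeScalarRingType R) :=
  { A of NormedAlgebra R D A & isBanachAlgebra R D A }.

HB.instance Definition _ (R : realType) (D : completeScalarRingType R)
    (A : banachAlgType D) :=
  PseudoMetricNormedZmod.copy A (A : normedRingType R).

(* [[pchar D] =i pred0] would not do: it also holds for, e.g., Z/6Z. *)
Definition char_zero (D : nzRingType) : Prop :=
  forall k : nat, (0 < k)%N -> k%:R != 0 :> D.

Section Derivative.
Context {R : realType} {D : completeScalarRingType R} {A : banachAlgType D}.
Implicit Types (f : A -> A) (x : A).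

(* [f (x + h) - f x = L h + o(h)], with [L] linear over [D]; the Landau
   notations of the library require a normed module over [R]. *)
Definition is_derivative f x (L : {linear A -> A}) : Prop :=
  forall e : R, 0 < e ->
    \forall h \near (0 : A), `|f (x + h) - f x - L h| <= e * `|h|.

Definition has_derivative f x : Prop := exists L, is_derivative f x L.

(* Total operator: the zero map where the derivative does not exist. *)
Definition derivative f x : {linear A -> A} :=
  if pselect (has_derivative f x) is left ex then projT1 (cid ex) else \0.

(* [higher_derivative f [:: h1; ..; hn] x] is [d^n f / dx^n o (h1, .., hn)]:
   [h1] is the direction of the first differentiation. *)
Definition higher_derivative f (hs : seq A) : A -> A :=
  foldl (fun g h x => derivative g x h) f hs.

Definition banach_exp x : A :=
  limn (series (fun k => (k`!%:R^-1 : R)%:A *: x ^+ k : A)).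

Definition quasiexp (cs : seq A) : A -> A := higher_derivative banach_exp cs.

End Derivative.

(* Main.v *)
From HB Require Import structures.
Require Import Defs.
From mathcomp Require Import all_boot all_order all_algebra.
From mathcomp Require Import all_classical all_reals all_analysis.
From mathcomp Require Import lra ring.

(* The dual numbers [A[eps]], [eps ^+ 2 = 0], form again a Banach [D]-algebra,
   and the exponential there satisfies
     [exp (x + c eps) = exp x + (dexp_x o c) eps].
   Hence [e[c1, c2, .., cn]^x] is the [eps]-coefficient of the quasiexponent
   [e[c2, .., cn]^(x + c1 eps)] of [A[eps]], and induction on [n], over all
   Banach [D]-algebras at once, reduces the differentiability of quasiexponents
   and the equation [dy/dx o 1 = y] to the case of the exponential itself. *)

Set Implicit Arguments.
Unset Strict Implicit.
Unset Printing Implicit Defensive.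

Import Order.TTheory GRing.Theory Num.Theory.
Import numFieldTopology.Exports numFieldNormedType.Exports.

Local Open Scope classical_set_scope.
Local Open Scope ring_scope.

(** * Dual numbers as a Banach algebra *)

Lemma rnorm_ge0 (R : realType) (T : normedRingType R) (x : T) : 0 <= rnorm x.
Proof. exact: (normr_ge0 x). Qed.

Lemma cauchy_nonexpansive (R : realType) (T U : normedRingType R) (f : T -> U)
    (F : set_system T) :
  ProperFilter F -> (forall x y, `|f x - f y| <= `|x - y|) ->
  cauchy F -> cauchy (f @ F).
Proof.
move=> FF fle /cauchy_ballP Fc; apply/cauchy_ballP => e e0.
rewrite near_map2; have := Fc e e0.
apply: filterS => -[x y] /=; rewrite -!ball_normE /=.
exact: le_lt_trans.
Qed.

(* The dual numbers [a + b eps], with [eps ^+ 2 = 0], encoded as [(a, b)]. *)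
Definition dual (R : realType) (D : completeScalarRingType R)
  (A : banachAlgType D) : Type := (A * A)%type.

Section Dual.
Context {R : realType} {D : completeScalarRingType R} (A : banachAlgType D).
Notation dA := (dual A).
HB.instance Definition _ := GRing.Lmodule.copy dA (A * A)%type.

Definition dual_one : dA := (1, 0).
Definition dual_mul (u v : dA) : dA := (u.1 * v.1, u.1 * v.2 + u.2 * v.1).

Fact dual_mulA : associative dual_mul.
Proof.
by move=> u v w; rewrite /dual_mul /= !mulrDr !mulrDl !mulrA addrA.
Qed.

Fact dual_mul1 : left_id dual_one dual_mul.
Proof. by case=> a b; rewrite /dual_mul /= !mul1r mul0r addr0. Qed.

Fact dual_mulr1 : right_id dual_one dual_mul.
Proof. by case=> a b; rewrite /dual_mul /= !mulr1 mulr0 add0r. Qed.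

Fact dual_mulDl : left_distributive dual_mul +%R.
Proof.
by move=> u v w; rewrite /dual_mul /= !mulrDl; congr pair; rewrite /= addrACA.
Qed.

Fact dual_mulDr : right_distributive dual_mul +%R.
Proof.
by move=> u v w; rewrite /dual_mul /= !mulrDr; congr pair; rewrite /= addrACA.
Qed.

Fact dual_one_neq0 : dual_one != 0.
Proof. by apply/eqP => /(congr1 fst) /= /eqP; rewrite oner_eq0. Qed.

HB.instance Definition _ := GRing.Zmodule_isNzRing.Build dA
  dual_mulA dual_mul1 dual_mulr1 dual_mulDl dual_mulDr dual_one_neq0.

Fact dual_scaleAl (d : D) (u v : dA) : d *: dual_mul u v = dual_mul (d *: u) v.
Proof. by congr pair; rewrite /= ?scalerDr !scalerAl. Qed.

HB.instance Definition _ := GRing.Lmodule_isLalgebra.Build D dA dual_scaleAl.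

Fact dual_scaleAr (d : D) (u v : dA) : d *: dual_mul u v = dual_mul u (d *: v).
Proof. by congr pair; rewrite /= ?scalerDr !scalerAr. Qed.

HB.instance Definition _ := GRing.Lalgebra_isAlgebra.Build D dA dual_scaleAr.

(** The sum rather than the maximum: the second component of a product is a sum of two products, so
    the same estimate for the maximum would cost a factor 2. *)
Definition dual_norm (u : dA) : R := rnorm u.1 + rnorm u.2.

Fact dual_normD u v : dual_norm (u + v) <= dual_norm u + dual_norm v.
Proof. by rewrite /dual_norm addrACA lerD ?ler_rnormD. Qed.

Fact dual_norm0 u : dual_norm u = 0 -> u = 0.
Proof.
case: u => a b /eqP; rewrite /dual_norm /= paddr_eq0 ?rnorm_ge0 //.
by case/andP=> /eqP/rnorm0_eq0 -> /eqP/rnorm0_eq0 ->.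
Qed.

Fact dual_normMn u n : dual_norm (u *+ n) = dual_norm u *+ n.
Proof.
have -> : u *+ n = (u.1 *+ n, u.2 *+ n).
  by elim: n => [//|n IH]; rewrite mulrS IH !mulrS.
by rewrite /dual_norm mulrnDl !rnormMn.
Qed.

Fact dual_normN u : dual_norm (- u) = dual_norm u.
Proof. by rewrite /dual_norm !rnormN. Qed.

Fact dual_normM (u v : dA) : dual_norm (u * v) <= dual_norm u * dual_norm v.
Proof.
rewrite /dual_norm /= mulrDl !mulrDr -addrA.
apply: lerD; first exact: ler_rnormM.
rewrite addrA; apply: (le_trans (ler_rnormD _ _)).
(* The surplus on the right is [rnorm u.2 * rnorm v.2], the term that eps^2 = 0 removes from the
   product. *)
by rewrite ler_wpDr ?mulr_ge0 ?rnorm_ge0// lerD ?ler_rnormM.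
Qed.

HB.instance Definition _ := hasRingNorm.Build R dA
  dual_normD dual_norm0 dual_normMn dual_normN dual_normM.

Fact dual_normZ (d : D) (u : dA) : rnorm (d *: u) <= rnorm d * rnorm u.
Proof. by rewrite /rnorm /= /dual_norm mulrDr lerD ?ler_rnormZ. Qed.

(** Both projections are nonexpansive, hence send a Cauchy filter to Cauchy filters on [A]; the
    limit is assembled from the two limits. *)
Fact dual_complete : complete_norm (dA : normedRingType R).
Proof.
move=> F FF Fc.
have c1 : cvg (fst @ F : set_system (A : normedRingType R)).
  apply: banach_complete; apply: (@cauchy_nonexpansive R dA A) => // x y.
  by rewrite lerDl rnorm_ge0.
have c2 : cvg (snd @ F : set_system (A : normedRingType R)).
  apply: banach_complete; apply: (@cauchy_nonexpansive R dA A) => // x y.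
  by rewrite lerDr rnorm_ge0.
move/cvg_ex : c1 => [a ca]; move/cvg_ex : c2 => [b cb].
apply/cvg_ex; exists ((a, b) : dA).
apply/cvgrPdist_lt => e e0.
near=> x.
rewrite (splitr e); apply: ltrD; near: x.
move/cvgrPdist_lt : ca; apply; exact: divr_gt0.
move/cvgrPdist_lt : cb; apply; exact: divr_gt0.
Unshelve. all: by end_near.
Qed.

HB.instance Definition _ :=
  isBanachAlgebra.Build R D dA dual_normZ dual_complete.

(* Without this instance, the norm found on [dA] would be the maximum norm of
   the product [A * A], to which [dA] unfolds. *)
HB.instance Definition _ :=
  PseudoMetricNormedZmod.copy dA (dA : normedRingType R).

End Dual.

(** * Uniqueness of the derivative *)

Section Derivative.
Context {R : realType} {D : completeScalarRingType R} {A : banachAlgType D}.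
Implicit Types (f : A -> A) (a x h : A) (r : R).

Lemma normr_scale (d : D) a : `|d *: a| <= rnorm d * `|a|.
Proof. exact: ler_rnormZ. Qed.

Lemma normr_mul a b : `|a * b : A| <= `|a| * `|b|.
Proof. exact: ler_rnormM. Qed.

Lemma normr_real_scale r a : `|(r%:A : D) *: a| <= `|r| * rnorm (1 : D) * `|a|.
Proof. by rewrite -rnormZ normr_scale. Qed.

(* Rescaling [h] by a small real brings it near [0]; the constant [rnorm 1]
   appears because the norm of [D] is not assumed to satisfy [rnorm 1 = 1]. *)
Lemma derivative_unique f x (L L' : {linear A -> A}) :
  is_derivative f x L -> is_derivative f x L' -> L =1 L'.
Proof.
move=> dL dL' h.
set K := rnorm (1 : D).
have K0 : 0 <= K := rnorm_ge0 _.
(* One factor [K] comes from scaling [h] by [t], the other from scaling back by [t^-1]; the 2 adds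
   the errors of [L] and [L']. *)
suff small : forall e : R, 0 < e -> `|L h - L' h| <= (K ^+ 2 * 2 * `|h|) * e.
  apply/eqP; rewrite -subr_eq0 -normr_le0; apply/ler_addgt0Pr => e e0.
  rewrite add0r.
  set C := K ^+ 2 * 2 * `|h| in small.
  have C0 : 0 <= C by rewrite !mulr_ge0 ?exprn_ge0.
  apply: (le_trans (small (e / (C + 1)) _)).
    by rewrite divr_gt0// ltr_wpDl.
  rewrite mulrCA ler_piMr ?(ltW e0)//.
  rewrite ler_pdivrMr ?mul1r ?lerDl// ltr_wpDl//.
move=> e e0.
have /nbhs_norm0P[/= d d0 Hd] : \forall k \near (0 : A),
    `|L k - L' k| <= 2 * e * `|k|.
  near=> k.
  have -> : L k - L' k =
      (f (x + k) - f x - L' k) - (f (x + k) - f x - L k).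
    by rewrite opprB [RHS]addrC addrA subrK.
  rewrite mulr_natl mulr2n mulrDl.
  rewrite (le_trans (ler_normB _ _))// lerD//; near: k; [exact: dL'|exact: dL].
(* The [+ 1] keeps the denominator positive and makes the bound t K |h| < d strict. *)
pose t := d / (K * `|h| + 1).
have Kh : 0 <= K * `|h| by rewrite mulr_ge0.
have t0 : 0 < t by rewrite divr_gt0// ltr_wpDl.
have tn0 : t != 0 by rewrite gt_eqF.
pose th := (t%:A : D) *: h.
have thle : `|th| <= t * K * `|h|.
  by have := normr_real_scale t h; rewrite gtr0_norm.
have /Hd : `|th| < d.
  apply: (le_lt_trans thle); rewrite -mulrA /t -mulrA gtr_pMr// mulrC.
  by rewrite ltr_pdivrMr ?mul1r ?ltrDl// ltr_wpDl.
rewrite /= /th !linearZ/= -scalerDr => Hth.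
have -> : L h - L' h = (t^-1%:A : D) *: ((t%:A : D) *: (L h - L' h)).
  by rewrite scalerA -scalerAl mul1r scalerA mulVf// !scale1r.
apply: (le_trans (normr_real_scale _ _)).
rewrite normfV gtr0_norm//.
apply: (@le_trans _ _ (t^-1 * K * (2 * e * (t * K * `|h|)))).
  rewrite ler_wpM2l ?mulr_ge0 ?invr_ge0 ?(ltW t0)//.
  by rewrite (le_trans Hth)// ler_wpM2l ?mulr_ge0// ltW.
by rewrite le_eqVlt; apply/orP; left; apply/eqP; field.
Unshelve. all: by end_near.
Qed.

Lemma derivativeE f x (L : {linear A -> A}) :
  is_derivative f x L -> derivative f x =1 L.
Proof.
move=> dL; rewrite /derivative; case: pselect => [ex|]; last by case; exists L.
by apply: derivative_unique dL; case: (cid ex).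
Qed.

Lemma derivativeP f x :
  has_derivative f x -> is_derivative f x (derivative f x).
Proof.
by rewrite /derivative; case: pselect => // ex _; case: (cid ex).
Qed.

End Derivative.

(** * Derivatives under composition with nonexpansive linear maps *)

Section Transfer.
Context {R : realType} {D : completeScalarRingType R} {A B : banachAlgType D}.
Variables (i : {linear A -> B}) (q : {linear B -> A}) (b : B).
Hypothesis (i_le : forall a, `|i a| <= `|a|) (q_le : forall y, `|q y| <= `|y|).

(** An increment [h] becomes the increment [i h] of [F]; as neither [i] nor [q] increases norms, the
    radius found for [F] and [e] still works. *)
Lemma is_derivative_conj (F : B -> B) x (L : {linear B -> B}) :
  is_derivative F (i x + b) L ->
  is_derivative (fun y => q (F (i y + b))) x (q \o L \o i : {linear A -> A}).
Proof.
move=> dF e e0; have /nbhs_norm0P[/= d d0 Fd] := dF e e0.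
apply/nbhs_norm0P; exists d => //= h hd.
rewrite linearD [i x + i h + b]addrAC -!raddfB/=.
apply: (le_trans (q_le _)).
apply: le_trans (_ : e * `|i h| <= _).
  by apply: Fd; rewrite /= (le_lt_trans (i_le _)).
by rewrite ler_wpM2l// ltW.
Qed.

(** Induction removes the last direction, the outermost differentiation. Differentiability is asked
    only for lists shorter than [hs], which is what the induction on quasiexponents can supply. *)
Lemma higher_derivative_conj (F : B -> B) hs :
  (forall ks, (size ks < size hs)%N ->
     forall y, has_derivative (higher_derivative F ks) y) ->
  higher_derivative (fun x => q (F (i x + b))) hs =
  (fun x => q (higher_derivative F (map i hs) (i x + b))).
Proof.
elim/last_ind: hs => [//|hs h IH] dF.
rewrite /higher_derivative map_rcons !foldl_rcons.
rewrite -/(higher_derivative _ hs) -/(higher_derivative _ (map i hs)).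
rewrite IH => [|ks lks y]; last by apply: dF; rewrite size_rcons ltnW.
apply/funext => x.
rewrite (derivativeE (is_derivative_conj (derivativeP (dF _ _ _))))//.
by rewrite size_map size_rcons.
Qed.

End Transfer.

(** * Series with factorial weights *)

Section Series.
Context {R : realType} {D : completeScalarRingType R}.
Implicit Types A B : banachAlgType D.

(** Comparison test: increments of the partial sums of [v] are bounded by those of [w], so the
    Cauchy property passes over and completeness applies. *)
Lemma cvg_series_dominated A (v : A ^nat) (w : R ^nat) :
  (forall k, `|v k| <= w k) -> cvgn (series w) ->
  cvgn (series v) /\ `|limn (series v) : A| <= limn (series w).
Proof.
move=> vw cw.
have le_series m n : (m <= n)%N ->
    `|series v n - series v m| <= series w n - series w m.
  move=> mn; rewrite !sub_series_geq//.
  by rewrite (le_trans (ler_norm_sum _ _ _))// ler_sum.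
have dist m n : `|series v n - series v m| <= `|series w n - series w m|.
  have [mn|/ltnW nm] := leqP m n.
    by rewrite (le_trans (le_series _ _ mn))// ler_norm.
  rewrite distrC [leRHS]distrC.
  by rewrite (le_trans (le_series _ _ nm))// ler_norm.
have cv : cvgn (series v).
  apply: banach_complete; apply/cauchy_ballP => e e0.
  have /cauchy_ballP/(_ _ e0) : cauchy (series w @ \oo) by exact: cvg_cauchy.
  rewrite !near_map2; apply: filterS => -[m n] /=.
  rewrite -!ball_normE /=; exact: le_lt_trans.
split=> //.
apply: (ler_cvg_to (cvg_norm cv) cw).
near=> n.
have := le_series 0%N n (leq0n _).
have s0 (V : zmodType) (u : V ^nat) : series u 0%N = 0.
  by rewrite /series/= big_geq.
by rewrite (s0 A) (s0 R) !subr0.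
Unshelve. all: by end_near.
Qed.

Lemma cvg_linear A B (f : {linear A -> B}) (C : R) (u : A ^nat) (l : A) :
  (forall a, `|f a| <= C * `|a|) -> u @ \oo --> l -> (f \o u) @ \oo --> f l.
Proof.
move=> fC /cvgrPdist_lt ul; apply/cvgrPdist_lt => e e0.
have C0 : 0 < `|C| + 1 by rewrite ltr_wpDl.
have := ul (e / (`|C| + 1)) (divr_gt0 e0 C0).
apply: filterS => n /=; rewrite ltr_pdivlMr// => lt.
rewrite -raddfB (le_lt_trans _ lt)// (le_trans (fC _))// mulrC ler_wpM2l//.
by rewrite (le_trans (ler_norm _))// lerDl.
Qed.

(** Arbitrary terms replace the powers, so that the exponential, its derivative and the remainder
    are all treated as instances. *)
Definition exp_series A (u : A ^nat) : A ^nat :=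
  series (fun k => (k`!%:R^-1 : R)%:A *: u k : A).

Lemma cvg_exp_series A (u : A ^nat) (C M : R) :
  (forall k, `|u k| <= C * M ^+ k) ->
  cvgn (exp_series u) /\
  `|limn (exp_series u) : A| <= rnorm (1 : D) * C * expR M.
Proof.
move=> uC; set K := rnorm (1 : D) * C.
have cw : series (fun k => K * exp_coeff M k) @ \oo --> K * expR M.
  rewrite (_ : series _ = fun n => K * series (exp_coeff M) n); last first.
    by apply/funext => n; rewrite /series/= mulr_sumr.
  apply: cvgMr; exact: is_cvg_series_exp_coeff.
rewrite -(cvg_lim _ cw)//.
apply: cvg_series_dominated; last by apply/cvg_ex; eexists; exact: cw.
move=> k; rewrite (le_trans (normr_real_scale _ _))//.
rewrite ger0_norm ?invr_ge0// -[leRHS]mulrA -mulrA mulrCA.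
rewrite ler_wpM2l ?rnorm_ge0//.
by rewrite /exp_coeff/= mulrA mulrC ler_wpM2r ?invr_ge0.
Qed.

Lemma exp_series_linear A B (f : {linear A -> B}) (u : A ^nat) :
  exp_series (f \o u) = f \o exp_series u.
Proof.
apply/funext => n; rewrite /exp_series /series /= linear_sum.
by apply: eq_bigr => k _; rewrite linearZ.
Qed.

Lemma exp_seriesD A (u v : A ^nat) :
  exp_series (fun k => u k + v k) = (fun n => exp_series u n + exp_series v n).
Proof.
apply/funext => n; rewrite /exp_series /series /= -big_split.
by apply: eq_bigr => k _; rewrite scalerDr.
Qed.

Lemma exp_seriesB A (u v : A ^nat) :
  exp_series (fun k => u k - v k) = (fun n => exp_series u n - exp_series v n).
Proof.
apply/funext => n; rewrite /exp_series /series /= -sumrB.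
by apply: eq_bigr => k _; rewrite scalerBr.
Qed.

End Series.

(** * The derivative of the exponential *)

Section ExpDerivative.
Context {R : realType} {D : completeScalarRingType R} {A : banachAlgType D}.
Implicit Types (x h : A).

(* [d(x^k)/dx o h], the sum of the [x^i h x^j] with [i + j = k - 1]. *)
Fixpoint dpow x h k : A :=
  if k is k'.+1 then x * dpow x h k' + h * x ^+ k' else 0.

Definition dexp x h : A := limn (exp_series (dpow x h)).

Lemma dpow_linear x k : linear (dpow x ^~ k).
Proof.
move=> d h h'; elim: k => [|k IH] /=; first by rewrite scaler0 addr0.
by rewrite IH mulrDl mulrDr scalerDr -!scalerAl -!scalerAr addrACA.
Qed.

(** As 1 commutes with [x], the [k.+1] summands all equal [x ^+ k]. *)
Lemma dpow1 x k : dpow x 1 k.+1 = x ^+ k *+ k.+1.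
Proof.
elim: k => [|k IH]; first by rewrite /= mulr0 add0r mulr1.
rewrite -[LHS]/(x * dpow x 1 k.+1 + 1 * x ^+ k.+1) IH.
by rewrite mul1r mulrnAr -exprS -mulrSr.
Qed.

Lemma norm_pow x (M : R) k : `|x| <= M -> `|x ^+ k| <= `|1 : A| * M ^+ k.
Proof.
move=> xM; elim: k => [|k IH]; first by rewrite !expr0 mulr1.
rewrite !exprS (le_trans (normr_mul _ _))// mulrCA.
exact: ler_pM.
Qed.

(** If T bounds [u k], then [x * u k] contributes at most M T, and [h * v k] at most T <= M T: hence
    the ratio [2 * M]. Each use gains a factor |h|. *)
Lemma norm_recurrence (u v : A ^nat) x h (C M : R) : 1 <= M -> `|x| <= M ->
  u 0%N = 0 -> (forall k, u k.+1 = x * u k + h * v k) ->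
  (forall k, `|v k| <= C * (2 * M) ^+ k) ->
  forall k, `|u k| <= C * `|h| * (2 * M) ^+ k.
Proof.
move=> M1 xM u0 uS vC; have M0 : 0 <= M := le_trans ler01 M1.
have C0 : 0 <= C.
  by have := vC 0%N; rewrite expr0 mulr1; apply: le_trans.
elim=> [|k IH]; first by rewrite u0 normr0 expr0 mulr1 mulr_ge0.
rewrite uS (le_trans (ler_normD _ _))//.
set T := C * `|h| * (2 * M) ^+ k in IH.
have T0 : 0 <= T by rewrite !mulr_ge0 ?exprn_ge0 ?mulr_ge0.
apply: (@le_trans _ _ (M * T + M * T)); last by rewrite /T exprS; lra.
apply: lerD; rewrite (le_trans (normr_mul _ _))//; first exact: ler_pM.
apply: (@le_trans _ _ T); last by rewrite ler_peMl.
by rewrite /T mulrAC mulrC ler_wpM2r.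
Qed.

Lemma norm_pow_double x (M : R) k : 1 <= M -> `|x| <= M ->
  `|x ^+ k| <= `|1 : A| * (2 * M) ^+ k.
Proof.
move=> M1 xM; apply: norm_pow; rewrite (le_trans xM)// ler_peMl// ?ler1n//.
exact: le_trans M1.
Qed.

Lemma norm_dpow x h (M : R) : 1 <= M -> `|x| <= M ->
  forall k, `|dpow x h k| <= `|1 : A| * `|h| * (2 * M) ^+ k.
Proof.
move=> M1 xM; apply: (@norm_recurrence _ (GRing.exp x) x) => // k.
exact: norm_pow_double.
Qed.

(** Two uses of [norm_recurrence]: the powers of [x + h] drive the recurrence of the differences of
    powers, and these drive that of the remainder, which gives |h| twice. *)
Lemma norm_pow_remainder x h (M : R) : 1 <= M -> `|x| <= M -> `|x + h| <= M ->
  forall k, `|(x + h) ^+ k - x ^+ k - dpow x h k| <=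
    `|1 : A| * `|h| * `|h| * (2 * M) ^+ k.
Proof.
move=> M1 xM xhM.
apply: (@norm_recurrence _ (fun k => (x + h) ^+ k - x ^+ k) x) => //.
- by rewrite !expr0 subrr subr0.
- move=> k; rewrite !exprS /= mulrDl !mulrBr opprD.
  rewrite -!addrA; congr (_ + _).
  by rewrite addrC -!addrA; congr (_ + _); congr (_ + _); rewrite addrC.
apply: (@norm_recurrence _ (GRing.exp (x + h)) x) => //.
- by rewrite !expr0 subrr.
- by move=> k; rewrite !exprS mulrDl mulrBr addrAC.
move=> k; exact: norm_pow_double.
Qed.

Lemma cvg_banach_exp x : exp_series (GRing.exp x) @ \oo --> banach_exp x.
Proof.
by have [] := cvg_exp_series (fun k => norm_pow k (lexx `|x|)).
Qed.

Lemma cvg_dexp x h : exp_series (dpow x h) @ \oo --> dexp x h.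
Proof.
have M1 : 1 <= 1 + `|x| by rewrite lerDl.
have xM : `|x| <= 1 + `|x| by rewrite lerDr.
by have [] := cvg_exp_series (norm_dpow h M1 xM).
Qed.

Lemma dexp_is_linear x : linear (dexp x).
Proof.
move=> d h h'.
apply: (cvg_lim (@norm_hausdorff _ _)).
have -> : exp_series (dpow x (d *: h + h')) =
   (fun n => d *: exp_series (dpow x h) n + exp_series (dpow x h') n).
  rewrite (_ : dpow _ _ = (fun k => ( *:%R d \o dpow x h) k + dpow x h' k)).
    by rewrite exp_seriesD exp_series_linear.
  by apply/funext => k; rewrite dpow_linear.
have cd : ( *:%R d \o exp_series (dpow x h)) @ \oo --> d *: dexp x h.
  by apply: cvg_linear (@cvg_dexp x h) => a; exact: normr_scale.
exact: cvgD cd (@cvg_dexp x h').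
Qed.

HB.instance Definition _ x :=
  GRing.isLinear.Build D A A *:%R (dexp x) (dexp_is_linear x).

Lemma is_derivative_exp x : is_derivative banach_exp x (dexp x).
Proof.
move=> e e0.
(* [M] bounds both [x] and [x + h] once |h| <= 1. Summing the power remainders bounds the remainder
   by K |h|^2, and |h| <= e / (K + 1) turns this into e |h|. *)
pose M := 1 + `|x|.
have M1 : 1 <= M by rewrite lerDl.
have M0 : 0 <= M := le_trans ler01 M1.
pose K := rnorm (1 : D) * `|1 : A| * expR (2 * M).
have K0 : 0 <= K by rewrite !mulr_ge0 ?rnorm_ge0 ?expR_ge0.
have K1 : 0 < K + 1 by rewrite ltr_wpDl.
near=> h.
have h1 : `|h| <= 1 by near: h; exact: nbhs0_le.
have he : `|h| <= e / (K + 1) by near: h; apply: nbhs0_le; exact: divr_gt0.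
have xM : `|x| <= M by rewrite lerDr.
have xhM : `|x + h| <= M by rewrite (le_trans (ler_normD _ _))// addrC lerD.
have [_] := cvg_exp_series (norm_pow_remainder M1 xM xhM).
rewrite 2!exp_seriesB.
have cr := cvgB (cvgB (@cvg_banach_exp (x + h)) (@cvg_banach_exp x))
  (@cvg_dexp x h).
rewrite (cvg_lim (@norm_hausdorff _ _) (cr _ _)).
move=> /le_trans; apply.
rewrite (_ : _ * _ = K * `|h| * `|h|); last by rewrite /K; ring.
rewrite ler_wpM2r//.
rewrite (le_trans (_ : _ <= (K + 1) * `|h|))// ?ler_wpM2r ?lerDl//.
by rewrite mulrC -ler_pdivlMr.
Unshelve. all: by end_near.
Qed.

(** By [dpow1], the term of index [k.+1] is x^k / k!, and the term of index 0 vanishes: this is the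
    exponential series shifted by one. *)
Lemma dexp1 x : dexp x 1 = banach_exp x.
Proof.
apply: (cvg_lim (@norm_hausdorff _ _)).
rewrite -cvg_shiftS.
rewrite (_ : [sequence _]_n = exp_series (GRing.exp x)).
  exact: cvg_banach_exp.
apply/funext => n; rewrite /exp_series /series /= big_nat_recl//= scaler0 add0r.
apply: eq_bigr => k _; rewrite -[X in _ *: X]/(dpow x 1 k.+1) dpow1.
rewrite -scalerMnr !scalerMnl; congr (_ *: _); congr (_ *: _).
by rewrite factS natrM invfM -mulr_natr mulrC mulrA mulfV ?mul1r// pnatr_eq0.
Qed.

End ExpDerivative.

(** * The exponential of dual numbers and the induction on quasiexponents *)

Section DualExp.
Context {R : realType} {D : completeScalarRingType R} {A : banachAlgType D}.

Definition dual_const (a : A) : dual A := (a, 0).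
Definition dual_coef (u : dual A) : A := u.2.

Fact dual_const_is_linear : linear dual_const.
Proof. by move=> d a b; congr pair; rewrite /= scaler0 addr0. Qed.

Fact dual_coef_is_linear : linear dual_coef.
Proof. by []. Qed.

HB.instance Definition _ :=
  GRing.isLinear.Build D A (dual A) *:%R dual_const dual_const_is_linear.
HB.instance Definition _ :=
  GRing.isLinear.Build D (dual A) A *:%R dual_coef dual_coef_is_linear.

Lemma norm_dual_const (a : A) : `|dual_const a| <= `|a|.
Proof. by change (rnorm a + `|0 : A| <= rnorm a); rewrite normr0 addr0. Qed.

Lemma norm_dual_coef (u : dual A) : `|dual_coef u| <= `|u|.
Proof.
by change (rnorm u.2 <= rnorm u.1 + rnorm u.2); rewrite lerDr rnorm_ge0.
Qed.

(** The second component of the product by [(x, c)] is the recurrence that defines [dpow]. *)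
Lemma dual_exprn (x c : A) k : ((x, c) : dual A) ^+ k = (x ^+ k, dpow x c k).
Proof. by elim: k => [//|k IH]; rewrite exprS IH exprS. Qed.

Lemma dual_coef_exp (x c : A) :
  dual_coef (banach_exp ((x, c) : dual A)) = dexp x c.
Proof.
apply/esym/(cvg_lim (@norm_hausdorff _ _)).
rewrite (_ : dpow x c = dual_coef \o GRing.exp ((x, c) : dual A)); last first.
  by apply/funext => k; rewrite /= dual_exprn.
rewrite exp_series_linear.
apply: (@cvg_linear _ _ _ _ _ 1) (@cvg_banach_exp _ _ _ _) => u.
by rewrite mul1r norm_dual_coef.
Qed.

End DualExp.

(** The length is bounded by [n] instead of fixed, because [higher_derivative_conj] needs
    differentiability for every shorter list. *)
Lemma quasiexp_derivative (R : realType) (D : completeScalarRingType R) n :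
  forall (A : banachAlgType D) (cs : seq A), (size cs < n)%N ->
  forall x, has_derivative (quasiexp cs) x /\
    derivative (quasiexp cs) x 1 = quasiexp cs x.
Proof.
elim: n => // n IH A [|c cs] /= lt_n x.
  split; first by exists (dexp x); exact: is_derivative_exp.
  by rewrite (derivativeE (@is_derivative_exp _ _ _ x))/= dexp1.
(* The first direction [c] is absorbed into the base point as the shift [(0, c)]; the other
   directions become constants of [dual A]. *)
have -> : quasiexp (c :: cs) = fun y => dual_coef
    (quasiexp (map dual_const cs) (dual_const y + ((0, c) : dual A))).
  rewrite -(higher_derivative_conj _ norm_dual_const norm_dual_coef).
    rewrite /quasiexp /higher_derivative /=; congr foldl; apply/funext => y.
    rewrite (derivativeE (@is_derivative_exp _ _ _ y))/= -dual_coef_exp.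
    by congr (dual_coef (banach_exp _)); congr pair; rewrite /= (addr0, add0r).
  move=> ks lt_ks y; have [|//] := IH _ ks _ y.
  exact: (ltn_trans lt_ks lt_n).
set b := (0, c) : dual A.
have [|dQ dQ1] := IH _ (map dual_const cs) _ (dual_const x + b).
  by rewrite size_map.
have dx := is_derivative_conj norm_dual_const norm_dual_coef (derivativeP dQ).
split; first by eexists; exact: dx.
(* [dual_const 1] is the unit of [dual A], so [dQ1] applies. *)
by rewrite (derivativeE dx) /= -dQ1.
Qed.

Theorem theorem8p3p6 (R : realType) (D : completeScalarRingType R)
    (D_char0 : char_zero D) (A : banachAlgType D)
    (n : nat) (n_ge1 : (1 <= n)%N) (c : n.-tuple A) :
  forall x : A,
    has_derivative (quasiexp c) x /\
    derivative (quasiexp c) x 1 = quasiexp c x.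
Proof. exact: quasiexp_derivative (ltnSn _). Qed.
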